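(* Let $G$ be a connected $d$-regular simple graph with $d\ge 3$ which is not $K_4$, $K_5$, or $K_{3,3}$. Then \[ \mathscr{K}_e(G)>\mathscr{K}_{nb}(G). \]
   Context: Kemeny's constant of an irreducible finite Markov chain with transition matrix $P$ whose eigenvalues (with multiplicity) are $1=\rho_1,\rho_2,\dots,\rho_N$ (with $1$ simple) is $\mathscr{K}(P)=\sum_{i=2}^{N}\frac{1}{1-\rho_i}$. Arcs of $G$: for each edge $\{u,v\}$ the two ordered pairs $(u,v),(v,u)$. $\mathscr{K}_e(G)$ is Kemeny's constant of the chain on arcs where from $(u,v)$ one moves to $(v,w)$ with probability $1/\deg(v)$ for each neighbor $w$ of $v$. $\mathscr{K}_{nb}(G)$ is Kemeny's constant of the non-backtracking chain on arcs where from $(u,v)$ one moves to $(v,w)$ with probability $1/(\deg(v)-1)$ for each neighbor $w\neq u$ of $v$. *)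

(* Defs.v *)
From mathcomp Require Import all_boot all_order all_algebra.
From mathcomp Require Import algC.
Set Implicit Arguments. Unset Strict Implicit. Unset Printing Implicit Defensive.
Import Order.TTheory GRing.Theory Num.Theory.
Local Open Scope ring_scope.

Definition simple_graph (V : finType) (e : rel V) : Prop :=
  (forall x y, e x y = e y x) /\ (forall x, ~~ e x x).

Definition deg (V : finType) (e : rel V) (v : V) : nat := #|[pred w | e v w]|.

Definition regular (V : finType) (e : rel V) (d : nat) : Prop :=
  forall v, deg e v = d.

Definition connected (V : finType) (e : rel V) : Prop :=
  forall x y, connect e x y.

Definition graph_iso (V W : finType) (e : rel V) (e' : rel W) : Prop :=
  exists f : V -> W, bijective f /\ forall x y, e x y = e' (f x) (f y).

Definition complete_rel (n : nat) : rel 'I_n := fun x y => x != y.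
Definition K33_rel : rel (bool * 'I_3) := fun x y => x.1 != y.1.

Definition arc (V : finType) (e : rel V) := {p : V * V | e p.1 p.2}.

Definition tmx (T : finType) (P : T -> T -> algC) : 'M[algC]_#|T| :=
  \matrix_(i, j) P (enum_val i) (enum_val j).

Definition Pe (V : finType) (e : rel V) (a b : arc e) : algC :=
  if (val a).2 == (val b).1 then (deg e (val a).2)%:R^-1 else 0.

Definition Pnb (V : finType) (e : rel V) (a b : arc e) : algC :=
  if ((val a).2 == (val b).1) && ((val b).2 != (val a).1)
  then ((deg e (val a).2)%:R - 1)^-1 else 0.

Lemma eigs_exists n (A : 'M[algC]_n) :
  exists rs : seq algC, char_poly A == \prod_(z <- rs) ('X - z%:P).
Proof.
have [rs Hrs] := closed_field_poly_normal (char_poly A).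
by exists rs; apply/eqP; rewrite Hrs (monicP (char_poly_monic A)) scale1r.
Qed.

Definition eigs n (A : 'M[algC]_n) : seq algC := xchoose (eigs_exists A).

Definition kemeny n (A : 'M[algC]_n) : algC :=
  \sum_(z <- rem 1 (eigs A)) (1 - z)^-1.

Definition Ke (V : finType) (e : rel V) : algC := kemeny (tmx (@Pe V e)).
Definition Knb (V : finType) (e : rel V) : algC := kemeny (tmx (@Pnb V e)).

(* Main.v *)
Require Import Defs.
From mathcomp Require Import all_boot all_order all_algebra.
From mathcomp Require Import algC.
From mathcomp Require Import spectral ring zify.
Import Order.TTheory GRing.Theory Num.Theory.
Local Open Scope ring_scope.
Set Implicit Arguments. Unset Strict Implicit. Unset Printing Implicit Defensive.

(** With [0^-1 = 0], Kemeny's constant is the sum of [(1 - z)^-1] over all roots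
    [z] of the characteristic polynomial, hence additive in that polynomial.
    Sylvester's identity for the simple chain and the Ihara-Bass identity for the
    non-backtracking chain express both characteristic polynomials through the
    eigenvalues [l_i] of the adjacency matrix, which yields
      [Ke - Knb = 2 S - n / d - 1 / (d - 2)],  [S = sum_(l_i <> d) 1 / (d - l_i)].
    Since the gaps [d - l_i] add up to [n d], AM-HM gives [S >= (n - 1)^2 / (n d)],
    which suffices unless [(n, d)] is [(4, 3)], [(5, 4)] or [(6, 3)]; the first two
    are [K_4] and [K_5].  In the last case a cubic minorant of [1 / (3 - l)] gives
    [S >= 3 / 2 + tr A^3 / 324], so that the inequality holds as soon as the graph
    contains a triangle, and the only triangle-free graph is [K_{3,3}]. *)

(** * Kemeny's constant as an additive function of the characteristic polynomial *)

Definition kemeny_poly (p : {poly algC}) : algC :=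
  \sum_(z <- sval (closed_field_poly_normal p)) (1 - z)^-1.

Lemma kemeny_poly_prod_XsubC (rs : seq algC) :
  kemeny_poly (\prod_(z <- rs) ('X - z%:P)) = \sum_(z <- rs) (1 - z)^-1.
Proof.
rewrite /kemeny_poly; case: closed_field_poly_normal => s /=.
rewrite (monicP (monic_prod_XsubC _ _ _)) scale1r => /prod_XsubC_eq.
by move=> rs_s; rewrite (perm_big _ rs_s).
Qed.

Lemma monic_splits (p : {poly algC}) :
  p \is monic -> exists rs : seq algC, p = \prod_(z <- rs) ('X - z%:P).
Proof.
case: (closed_field_poly_normal p) => rs pE /monicP lp.
by exists rs; rewrite {1}pE lp scale1r.
Qed.

Lemma kemeny_polyM (p q : {poly algC}) : p \is monic -> q \is monic ->
  kemeny_poly (p * q) = kemeny_poly p + kemeny_poly q.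
Proof.
move=> /monic_splits[s ->] /monic_splits[t ->].
by rewrite -big_cat !kemeny_poly_prod_XsubC big_cat.
Qed.

Lemma kemeny_poly1 : kemeny_poly 1 = 0.
Proof. by have := kemeny_poly_prod_XsubC [::]; rewrite !big_nil. Qed.

Lemma kemeny_poly_prod (I : Type) (r : seq I) (F : I -> {poly algC}) :
  (forall i, F i \is monic) ->
  kemeny_poly (\prod_(i <- r) F i) = \sum_(i <- r) kemeny_poly (F i).
Proof.
move=> Fm; elim: r => [|i r IHr]; first by rewrite !big_nil kemeny_poly1.
by rewrite !big_cons kemeny_polyM ?IHr ?monic_prod.
Qed.

Lemma kemeny_polyX (p : {poly algC}) k : p \is monic ->
  kemeny_poly (p ^+ k) = kemeny_poly p *+ k.
Proof.
move=> pm; elim: k => [|k IHk]; first by rewrite expr0 kemeny_poly1.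
by rewrite exprS kemeny_polyM ?monic_exp // IHk mulrS.
Qed.

Lemma kemeny_poly_XsubC a : kemeny_poly ('X - a%:P) = (1 - a)^-1.
Proof. by have := kemeny_poly_prod_XsubC [:: a]; rewrite !big_seq1. Qed.

Lemma kemeny_poly_quad a b :
  kemeny_poly (('X - a%:P) * ('X - b%:P)) = (1 - a)^-1 + (1 - b)^-1.
Proof. by rewrite kemeny_polyM ?monicXsubC // !kemeny_poly_XsubC. Qed.

(* Deleting one eigenvalue [1] changes nothing, because [0^-1 = 0]. *)
Lemma kemenyE n (A : 'M[algC]_n) : kemeny A = kemeny_poly (char_poly A).
Proof.
rewrite /kemeny; have /eqP -> := xchooseP (eigs_exists A).
rewrite kemeny_poly_prod_XsubC -/(eigs A).
have [s1|s1] := boolP (1 \in eigs A); last by rewrite rem_id.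
by rewrite [RHS](big_rem 1 s1) /= subrr invr0 add0r.
Qed.

(** Multiplying [M] by a block lower triangular matrix, once on each side, makes it block upper
    triangular and evaluates its determinant in two ways. The powers of [a] avoid any division,
    since [a] will be a polynomial. *)
Lemma det_sylvester (R : comNzRingType) m n (a : R)
    (U : 'M[R]_(m, n)) (W : 'M[R]_(n, m)) :
  \det (a%:M - U *m W) * a ^+ n = a ^+ m * \det (a%:M - W *m U).
Proof.
pose M := block_mx a%:M U W 1%:M.
have detM : \det M = \det (a%:M - U *m W).
  have -> : \det M = \det (M *m block_mx 1%:M 0 (- W) 1%:M).
    by rewrite det_mulmx det_lblock !det1 !mulr1.
  rewrite mulmx_block !mulmx1 !mulmx0 !mulmxN mul1mx subrr !add0r.
  by rewrite det_ublock det1 mulr1.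
transitivity (\det (block_mx 1%:M 0 (- W) a%:M *m M)).
  by rewrite det_mulmx det_lblock det1 mul1r det_scalar mulrC detM.
rewrite mulmx_block !mul1mx !mul0mx !addr0 mulmx1.
rewrite mulNmx mul_mx_scalar mul_scalar_mx addNr mulNmx addrC.
by rewrite det_ublock det_scalar.
Qed.

(** * Matrices indexed by finite types *)

Definition fmx (R : Type) (I J : finType) (F : I -> J -> R) : 'M[R]_(#|I|, #|J|) :=
  \matrix_(i, j) F (enum_val i) (enum_val j).

Lemma big_enum_valT (R : nmodType) (I : finType) (F : I -> R) :
  \sum_(i < #|I|) F (enum_val i) = \sum_i F i.
Proof. by rewrite -[LHS](big_enum_val (A := I) F). Qed.

Lemma fmxM (R : pzSemiRingType) (I J K : finType) (F : I -> J -> R) (G : J -> K -> R) :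
  fmx F *m fmx G = fmx (fun i k => \sum_j F i j * G j k).
Proof.
apply/matrixP => i k; rewrite !mxE -(big_enum_valT (fun j => F _ j * G j _)).
by apply: eq_bigr => j _; rewrite !mxE.
Qed.

Lemma eq_fmx (R : Type) (I J : finType) (F G : I -> J -> R) :
  (forall i j, F i j = G i j) -> fmx F = fmx G.
Proof. by move=> FG; apply/matrixP => i j; rewrite !mxE. Qed.

Lemma tr_fmx (R : Type) (I J : finType) (F : I -> J -> R) :
  (fmx F)^T = fmx (fun j i => F i j).
Proof. by apply/matrixP => i j; rewrite !mxE. Qed.

Lemma scale_fmx (R : pzSemiRingType) (I J : finType) (F : I -> J -> R) a :
  a *: fmx F = fmx (fun i j => a * F i j).
Proof. by apply/matrixP => i j; rewrite !mxE. Qed.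

Lemma opp_fmx (R : pzRingType) (I J : finType) (F : I -> J -> R) :
  - fmx F = fmx (fun i j => - F i j).
Proof. by apply/matrixP => i j; rewrite !mxE. Qed.

Lemma add_fmx (R : pzRingType) (I J : finType) (F G : I -> J -> R) :
  fmx F + fmx G = fmx (fun i j => F i j + G i j).
Proof. by apply/matrixP => i j; rewrite !mxE. Qed.

Lemma scalar_fmx (R : pzSemiRingType) (I : finType) (a : R) :
  a%:M = fmx (fun i j : I => a *+ (i == j)).
Proof. by apply/matrixP => i j; rewrite !mxE (inj_eq enum_val_inj). Qed.

Lemma trace_fmx (R : pzSemiRingType) (I : finType) (F : I -> I -> R) :
  \tr (fmx F) = \sum_i F i i.
Proof.
rewrite -(big_enum_valT (fun i => F i i)).
by apply: eq_bigr => i _; rewrite mxE.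
Qed.

Lemma sum_indicator (R : nzSemiRingType) (I : finType) (i : I) (F : I -> R) :
  \sum_j (i == j)%:R * F j = F i.
Proof.
rewrite (bigD1 i) //= eqxx mul1r big1 ?addr0 // => j ji.
by rewrite eq_sym (negPf ji) mul0r.
Qed.

(** * The Ihara-Bass identity for abstract incidence matrices *)

Section IharaBass.
Variables (R : comNzRingType) (m n : nat) (J : 'M[R]_m) (c : R).
Hypothesis JJ : J *m J = 1%:M.
Notation "A '^P'" := (map_mx polyC A) (at level 2, format "A '^P'").

Let JJP : J^P *m J^P = 1%:M.
Proof. by rewrite -map_mxM JJ map_scalar_mx. Qed.

Lemma char_poly_scaled (A : 'M[R]_m) :
  char_poly (c *: A) = \det ('X%:M - c%:P *: A^P).
Proof. by rewrite /char_poly /char_poly_mx map_mxZ. Qed.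

(** Conjugation by [D] turns [J] into [- J], so the determinants of [X - c J] and [X + c J] agree,
    and their product is that of [X^2 - c^2]. *)
Lemma char_poly_involution_sq (D : 'M[R]_m) :
  D *m D = 1%:M -> D *m J = - (J *m D) ->
  char_poly (c *: J) ^+ 2 = ('X^2 - (c ^+ 2)%:P) ^+ m.
Proof.
move=> DD DJ.
have DDP : D^P *m D^P = 1%:M by rewrite -map_mxM DD map_scalar_mx.
have DJP : D^P *m J^P = - (J^P *m D^P) by rewrite -!map_mxM DJ map_mxN.
have conjD : D^P *m ('X%:M - c%:P *: J^P) *m D^P = 'X%:M + c%:P *: J^P.
  rewrite mulmxBr mulmxBl mul_mx_scalar -scalemxAl DDP scalemx1.
  by rewrite -scalemxAr DJP scalerN mulNmx -scalemxAl -mulmxA DDP mulmx1 opprK.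
have dD : \det D^P * \det D^P = 1 by rewrite -det_mulmx DDP det1.
have pJ : char_poly (c *: J) = \det ('X%:M + c%:P *: J^P).
  by rewrite -conjD !det_mulmx mulrAC dD mul1r char_poly_scaled.
rewrite expr2 {2}pJ char_poly_scaled -det_mulmx -det_scalar.
congr (\det _).
rewrite mulmxBl !mulmxDr !mul_scalar_mx mul_mx_scalar -scalemxAl -scalemxAr JJP.
by apply/matrixP => i j; rewrite !mxE; case: (i == j) => /=; rewrite ?rmorphXn /=; ring.
Qed.

Variables (S : 'M[R]_(n, m)) (T : 'M[R]_(m, n)) (d : nat).
Hypotheses (JT : J *m T = S^T) (SS : S *m S^T = d%:R%:M).
Hypothesis cd : c * (d%:R - 1) = 1.

(* Multiplying by [X - c J] removes the reversal from [X - c (T S - J)], and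
   Sylvester's identity then moves the determinant from arcs to vertices. *)
Lemma ihara_bass :
  char_poly (c *: J) * char_poly (c *: (T *m S - J)) * ('X^2 - (c ^+ 2)%:P) ^+ n
  = ('X^2 - (c ^+ 2)%:P) ^+ m
    * \det (('X^2 + c%:P)%:M - (c%:P * 'X) *: (S *m T)^P).
Proof.
(* Chosen so that [(X - c J) (X - c (T S - J)) = X^2 - c^2 - U S], by [J J = 1] and [J T = S^T]. *)
pose U := c%:P *: ('X *: T^P - c%:P *: (S^T)^P).
have -> : ('X^2 + c%:P)%:M - (c%:P * 'X) *: (S *m T)^P
          = ('X^2 - (c ^+ 2)%:P)%:M - S^P *m U.
  rewrite /U -scalemxAr mulmxBr -!scalemxAr -!map_mxM SS map_scalar_mx /=.
  have cdP : c%:P * (d%:R%:P - 1) = 1 :> {poly R} by rewrite -polyC1 -polyCB -polyCM cd.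
  move: ((S *m T)^P) => A; apply/matrixP => i j; rewrite !mxE.
  case: (i == j) => /=; rewrite ?rmorphXn /=; last by ring.
  (* [S S^T = d] contributes [c^2 d] to the diagonal, and [c^2 (d - 1) = c]. *)
  have -> : 'X^2 + c%:P = 'X^2 + c%:P * (c%:P * (d%:R%:P - 1)) :> {poly R}
    by rewrite cdP mulr1.
  by ring.
rewrite -det_sylvester; congr (_ * _).
rewrite !char_poly_scaled -det_mulmx; congr (\det _).
rewrite mulmxBl !mulmxBr !mul_scalar_mx mul_mx_scalar -scalemxAl -scalemxAr.
have JTP : J^P *m T^P = (S^T)^P by rewrite -map_mxM JT.
rewrite map_mxB map_mxM mulmxBr JJP mulmxA JTP.
rewrite /U -scalemxAl mulmxBl -!scalemxAl.
move: ((S^T)^P *m _) (T^P *m _) (J^P) => A B K; apply/matrixP => i j; rewrite !mxE.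
by case: (i == j) => /=; rewrite ?rmorphXn /=; ring.
Qed.

End IharaBass.

Local Notation arc := Defs.arc.

(** * Arcs of a regular graph and the two transition matrices *)

Section Arcs.
Variables (V : finType) (e : rel V) (d : nat).
Hypotheses (esimple : simple_graph e) (ereg : regular e d).
Let n := #|V|.

Let esym x y : e x y = e y x. Proof. exact: esimple.1. Qed.
Let eirr x : e x x = false. Proof. exact/negbTE/esimple.2. Qed.

Lemma sum_arc (F : V -> V -> algC) :
  \sum_(a : arc e) F (val a).1 (val a).2 = \sum_x \sum_y (e x y)%:R * F x y.
Proof.
rewrite pair_big /=.
transitivity (\sum_(p : V * V | e p.1 p.2) F p.1 p.2); last first.
  by rewrite big_mkcond; apply: eq_bigr => p _; case: (e _ _); rewrite (mul1r, mul0r).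
rewrite (reindex_omap (val : arc e -> _) insub) /=.
  by apply: eq_bigl => a; rewrite (valP a) valK eqxx.
by move=> p ep; case: insubP => [a _ /= ->|/negP].
Qed.

Lemma sum_nbr x : \sum_y (e x y)%:R = d%:R :> algC.
Proof.
rewrite -(ereg x) /deg -sum1_card natr_sum [RHS]big_mkcond /=.
by apply: eq_bigr => y _; rewrite inE; case: (e x y).
Qed.

Lemma card_arc : #|{: arc e}|%:R = (n * d)%:R :> algC.
Proof.
rewrite -sum1_card natr_sum (eq_bigl predT) //.
rewrite (sum_arc (fun _ _ => 1)).
under eq_bigr do under eq_bigr do rewrite mulr1.
by under eq_bigr do rewrite sum_nbr; rewrite sumr_const natrM mulr_natl.
Qed.

Definition adj : 'M[algC]_n := fmx (fun x y => (e x y)%:R).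
(** Incidence of arcs with their final ([T]) and initial ([S]) vertices: [T *m S] records which arc
    may follow which, while [S *m T] is the adjacency matrix. *)
Let T : 'M[algC]_(#|{: arc e}|, n) := fmx (fun a v => ((val a).2 == v)%:R).
Let S : 'M[algC]_(n, #|{: arc e}|) := fmx (fun v a => (v == (val a).1)%:R).

Definition arc_rev (a : arc e) : arc e :=
  exist _ ((val a).2, (val a).1) (etrans (esym _ _) (valP a)).

Lemma arc_revK : involutive arc_rev.
Proof. by move=> a; apply: val_inj => /=; case: (val a). Qed.

Let J : 'M[algC]_#|{: arc e}| := fmx (fun a b => (arc_rev a == b)%:R).

Let JJ : J *m J = 1%:M.
Proof.
rewrite fmxM scalar_fmx; apply: eq_fmx => a b.
by rewrite (sum_indicator _ (fun b' => (arc_rev b' == b)%:R)) arc_revK.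
Qed.

Let JT : J *m T = S^T.
Proof.
rewrite fmxM tr_fmx; apply: eq_fmx => a v.
by rewrite (sum_indicator _ (fun b => ((val b).2 == v)%:R)) eq_sym.
Qed.

Let ST : S *m T = adj.
Proof.
rewrite fmxM; apply: eq_fmx => x y.
rewrite (sum_arc (fun u v => (x == u)%:R * (v == y)%:R)).
under eq_bigr do under eq_bigr do rewrite mulrCA.
under eq_bigr do rewrite -mulr_sumr.
rewrite sum_indicator.
by under eq_bigr do rewrite mulrC eq_sym; rewrite sum_indicator.
Qed.

Let SS : S *m S^T = d%:R%:M.
Proof.
rewrite tr_fmx fmxM scalar_fmx; apply: eq_fmx => x y.
rewrite (sum_arc (fun u v => (x == u)%:R * (y == u)%:R)).
under eq_bigr do under eq_bigr do rewrite mulrCA.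
under eq_bigr do rewrite -mulr_sumr.
rewrite sum_indicator -mulr_suml sum_nbr mulr_natr.
by rewrite eq_sym.
Qed.

Let TS : T *m S = fmx (fun a b : arc e => ((val a).2 == (val b).1)%:R).
Proof.
by rewrite fmxM; apply: eq_fmx => a b; rewrite sum_indicator.
Qed.

Lemma PeE : tmx (@Pe V e) = d%:R^-1 *: (T *m S).
Proof.
rewrite TS scale_fmx; apply: eq_fmx => a b.
by rewrite /Pe ereg; case: eqP; rewrite ?mulr1 ?mulr0.
Qed.

Lemma PnbE : tmx (@Pnb V e) = (d%:R - 1)^-1 *: (T *m S - J).
Proof.
rewrite TS opp_fmx add_fmx scale_fmx; apply: eq_fmx => a b.
rewrite /Pnb ereg -val_eqE /= -pair_eqE /pair_eq /= [_.1 == _.2]eq_sym.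
by case: (_ == _); case: (_ == _); rewrite /= ?subrr ?subr0 ?mulr1 ?mulr0.
Qed.

(* Orienting each edge arbitrarily gives signs that anticommute with reversal. *)
Let sg (a : arc e) : algC :=
  if (enum_rank (val a).1 < enum_rank (val a).2)%N then 1 else -1.
Let D : 'M[algC]_#|{: arc e}| := fmx (fun a b => (a == b)%:R * sg b).

Let sg_rev a : sg (arc_rev a) = - sg a.
Proof.
rewrite /sg /=; case: ltngtP; rewrite ?opprK // => /val_inj /enum_rank_inj aa.
by have := valP a; rewrite /= aa eirr.
Qed.

Let DD : D *m D = 1%:M.
Proof.
rewrite fmxM scalar_fmx; apply: eq_fmx => a b.
under eq_bigr do rewrite -mulrA.
rewrite sum_indicator; have [->|_] := eqVneq; last by rewrite mul0r mulr0.
by rewrite mul1r /sg; case: ifP; rewrite ?mulrNN ?mulr1.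
Qed.

Let DJ : D *m J = - (J *m D).
Proof.
rewrite !fmxM opp_fmx; apply: eq_fmx => a b.
under eq_bigr do rewrite -mulrA.
rewrite !sum_indicator; have [<-|_] := eqVneq; last by rewrite mul0r mulr0 oppr0.
by rewrite mul1r mulr1 sg_rev opprK.
Qed.

Lemma char_poly_Pe :
  char_poly (tmx (@Pe V e)) * 'X^n
  = 'X^#|{: arc e}| * \det ('X%:M - (d%:R^-1)%:P *: map_mx polyC adj).
Proof.
rewrite PeE char_poly_scaled map_mxM scalemxAl det_sylvester.
by rewrite -scalemxAr -map_mxM ST.
Qed.

(** The Ihara-Bass identity is squared because [char_poly (c *: J)] is known only through its
    square. The common factors stay, as additivity of Kemeny's constant handles them. *)
Lemma char_poly_Pnb (c := (d%:R - 1)^-1) : (2 <= d)%N ->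
  char_poly (tmx (@Pnb V e)) ^+ 2 * ('X^2 - (c ^+ 2)%:P) ^+ #|{: arc e}|
    * (('X^2 - (c ^+ 2)%:P) ^+ n) ^+ 2
  = (('X^2 - (c ^+ 2)%:P) ^+ #|{: arc e}|
    * \det (('X^2 + c%:P)%:M - (c%:P * 'X) *: map_mx polyC adj)) ^+ 2.
Proof.
move=> d2; have cd : c * (d%:R - 1) = 1.
  by apply: mulVf; rewrite subr_eq0 pnatr_eq1; case: d d2 => [|[]].
rewrite -ST -(ihara_bass JJ JT SS cd) PnbE -/c.
by rewrite -(char_poly_involution_sq c JJ DD DJ); ring.
Qed.

End Arcs.

(** * Spectrum of the adjacency matrix of a connected regular graph *)

Section Spectrum.
Variables (V : finType) (e : rel V) (d : nat).
Hypotheses (esimple : simple_graph e) (econn : connected e) (ereg : regular e d).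
Let n := #|V|.
Let A := adj e.

Let esym x y : e x y = e y x. Proof. exact: esimple.1. Qed.

(** This is the Dirichlet form: expanding the square gives two diagonal sums with factor [d] and two
    cross sums with factor [l]. Its nonnegativity will bound [l] by [d]. *)
Lemma edge_form_eigenvector (v : V -> algC) (l : algC) :
  l^* = l -> (forall x, \sum_y (e x y)%:R * v y = l * v x) ->
  \sum_x \sum_y (e x y)%:R * `|v x - v y| ^+ 2
  = 2 * (d%:R - l) * \sum_x `|v x| ^+ 2.
Proof.
move=> lR veig.
have veigC x : \sum_y (e x y)%:R * (v y)^* = l * (v x)^*.
  rewrite -{1}lR -rmorphM -veig rmorph_sum; apply: eq_bigr => y _.
  by rewrite rmorphM rmorph_nat.
have diag1 : \sum_x \sum_y (e x y)%:R * `|v x| ^+ 2 = d%:R * \sum_x `|v x| ^+ 2.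
  by rewrite mulr_sumr; apply: eq_bigr => x _; rewrite -mulr_suml (sum_nbr ereg).
have diag2 : \sum_x \sum_y (e x y)%:R * `|v y| ^+ 2 = d%:R * \sum_x `|v x| ^+ 2.
  rewrite exchange_big -diag1; apply: eq_bigr => y _; apply: eq_bigr => x _.
  by rewrite esym.
have cross1 : \sum_x \sum_y (e x y)%:R * (v x * (v y)^*) = l * \sum_x `|v x| ^+ 2.
  rewrite mulr_sumr; apply: eq_bigr => x _.
  by under eq_bigr do rewrite mulrCA; rewrite -mulr_sumr veigC normCK; ring.
have cross2 : \sum_x \sum_y (e x y)%:R * (v y * (v x)^*) = l * \sum_x `|v x| ^+ 2.
  rewrite mulr_sumr; apply: eq_bigr => x _.
  by under eq_bigr do rewrite mulrA; rewrite -mulr_suml veig normCK; ring.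
transitivity (\sum_x \sum_y ((e x y)%:R * `|v x| ^+ 2 + (e x y)%:R * `|v y| ^+ 2
   - (e x y)%:R * (v x * (v y)^*) - (e x y)%:R * (v y * (v x)^*))).
  apply: eq_bigr => x _; apply: eq_bigr => y _.
  by rewrite !normCK rmorphB /=; ring.
under eq_bigr do rewrite !sumrB big_split /=.
by rewrite !sumrB big_split /= diag1 diag2 cross1 cross2; ring.
Qed.

(** The Dirichlet form vanishes at [l = d], hence so does each of its nonnegative terms; [v] is then
    constant along edges, and along paths by connectedness. *)
Lemma degree_eigenvector_const (v : V -> algC) :
  (forall x, \sum_y (e x y)%:R * v y = d%:R * v x) -> forall x y, v x = v y.
Proof.
move=> veig x y.
have := edge_form_eigenvector (rmorph_nat _ d) veig.
rewrite subrr mulr0 mul0r => /psumr_eq0P sum0.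
have term_ge0 (u w : V) : 0 <= (e u w)%:R * `|v u - v w| ^+ 2.
  by rewrite mulr_ge0 ?ler0n ?exprn_ge0.
have eqv u w : e u w -> v u = v w.
  move=> euw; have /psumr_eq0P := sum0 (fun u _ => sumr_ge0 _ (fun w _ => term_ge0 u w)) u isT.
  move/(_ (fun w _ => term_ge0 u w) w isT)/eqP.
  by rewrite euw mul1r sqrf_eq0 normr_eq0 subr_eq0 => /eqP.
case/connectP: (econn x y) => p; elim: p x => [|z p IHp] x /=; first by move=> _ ->.
by case/andP => /eqv -> /IHp/[apply].
Qed.

Let Areal : map_mx Num.conj A^T = A.
Proof. by apply/matrixP => i j; rewrite !mxE rmorph_nat esym. Qed.

Let Aherm : A \is hermsymmx.
Proof. by apply/is_hermitianmxP; rewrite expr0 scale1r Areal. Qed.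

Let P := spectralmx A.
Let lam i := spectral_diag A 0 i.

Let Punit : P \in unitmx. Proof. exact: spectral_unit. Qed.

Let AE : A = invmx P *m diag_mx (spectral_diag A) *m P.
Proof. exact/orthomx_spectralP/hermitian_normalmx. Qed.

Let lamR i : (lam i)^* = lam i.
Proof. by apply/CrealP; have /mxOverP := hermitian_spectral_diag_real Aherm; apply. Qed.

Let v i x := P i (enum_rank x).

Let veig i x : \sum_y (e x y)%:R * v i y = lam i * v i x.
Proof.
have PA : P *m A = diag_mx (spectral_diag A) *m P by rewrite {1}AE !mulmxA mulmxV // mul1mx.
move/matrixP/(_ i (enum_rank x)): PA; rewrite mul_diag_mx !mxE -/(v i x) => <-.
rewrite -big_enum_valT; apply: eq_bigr => j _.
by rewrite mxE enum_rankK esym mulrC /v enum_valK.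
Qed.

Let v_neq0 i : exists x, v i x != 0.
Proof.
apply/existsP; rewrite -negb_forall; apply/negP => /forallP vi0.
have : row i P *m invmx P = 0.
  apply/matrixP => k j; rewrite !mxE big1 // => l _.
  by have /eqP := vi0 (enum_val l); rewrite mxE /v enum_valK => ->; rewrite mul0r.
rewrite -row_mul mulmxV // => /matrixP/(_ 0 i); rewrite !mxE eqxx => /eqP.
by rewrite oner_eq0.
Qed.

Let v_norm i : 0 < \sum_x `|v i x| ^+ 2.
Proof.
have [x vx] := v_neq0 i; rewrite (bigD1 x) //= ltr_wpDr ?exprn_gt0 ?normr_gt0 //.
by apply: sumr_ge0 => y _; rewrite exprn_ge0.
Qed.

Let lam_bound i : 0 <= d%:R - lam i.
Proof.
have : 0 <= 2 * (d%:R - lam i) * \sum_x `|v i x| ^+ 2.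
  rewrite -(edge_form_eigenvector (lamR i) (veig i)).
  by apply: sumr_ge0 => x _; apply: sumr_ge0 => y _; rewrite mulr_ge0 ?ler0n ?exprn_ge0.
by rewrite pmulr_lge0 // pmulr_rge0 ?ltr0n.
Qed.

(** Two such rows of [P] would both be constant, hence linearly dependent, against the invertibility
    of [P]. *)
Let lam_degree_unique i j : lam i = d%:R -> lam j = d%:R -> i = j.
Proof.
move=> li lj; apply/eqP/negPn/negP => neq_ij.
have [x0 vx0] := v_neq0 i.
have vi x : v i x = v i x0 by apply: degree_eigenvector_const => y; rewrite -li veig.
have vj x : v j x = v j x0 by apply: degree_eigenvector_const => y; rewrite -lj veig.
have : (v j x0 *: row i P - v i x0 *: row j P) *m invmx P = 0.
  suff -> : v j x0 *: row i P - v i x0 *: row j P = 0 by rewrite mul0mx.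
  apply/matrixP => k l; rewrite !mxE.
  have := vi (enum_val l); have := vj (enum_val l); rewrite /v enum_valK => -> ->.
  by rewrite mulrC subrr.
rewrite mulmxBl -!scalemxAl -!row_mul mulmxV // => /matrixP/(_ 0 j).
rewrite !mxE eqxx (negPf neq_ij) mulr0 mulr1 sub0r => /eqP.
by rewrite oppr_eq0 (negPf vx0).
Qed.

(** The all-ones row is an eigenvector for [d], nonzero thanks to [v0]; any nonzero coordinate of it
    in the basis of rows of [P] points to the eigenvalue. *)
Let lam_degree_exists (v0 : V) : exists i, lam i = d%:R.
Proof.
pose u : 'rV[algC]_n := const_mx 1.
have uA : u *m A = d%:R *: u.
  apply/matrixP => k j; rewrite !mxE mulr1 -(sum_nbr ereg (enum_val j)) -[RHS]big_enum_valT.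
  by apply: eq_bigr => i _; rewrite !mxE mul1r esym.
pose w := u *m invmx P.
have wD : w *m diag_mx (spectral_diag A) = d%:R *: w.
  by rewrite /w scalemxAl -uA {2}AE -!mulmxA mulmxV // mulmx1.
have w_neq0 : w != 0.
  apply: contraNneq (oner_neq0 algC) => w0.
  have : w *m P = u by rewrite mulmxKV.
  by rewrite w0 mul0mx => /matrixP/(_ 0 (enum_rank v0)); rewrite !mxE => <-.
move: w wD w_neq0 => w wD /rV0Pn[i wi]; exists i.
by move/matrixP/(_ 0 i): wD; rewrite mul_mx_diag !mxE mulrC => /(mulIf wi).
Qed.

(** Arbitrary [f] and [g] serve both chains: [X] and [1 / d] for the simple one, [X^2 + c] and [c X]
    for the non-backtracking one. *)
Let det_adj (f g : {poly algC}) :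
  \det (f%:M - g *: map_mx polyC A) = \prod_i (f - g * (lam i)%:P).
Proof.
pose Q := map_mx polyC P; pose Q' := map_mx polyC (invmx P).
have QQ : Q' *m Q = 1%:M by rewrite -map_mxM mulVmx // map_scalar_mx.
have -> : f%:M - g *: map_mx polyC A
    = Q' *m (f%:M - g *: map_mx polyC (diag_mx (spectral_diag A))) *m Q.
  rewrite mulmxBr mulmxBl mul_mx_scalar -scalemxAl QQ scalemx1.
  by rewrite -scalemxAr -scalemxAl -!map_mxM -AE.
rewrite !det_mulmx mulrAC -det_mulmx QQ det1 mul1r.
pose r : 'rV[{poly algC}]_n := \row_i (f - g * (lam i)%:P).
have -> : f%:M - g *: map_mx polyC (diag_mx (spectral_diag A)) = diag_mx r.
  apply/matrixP => i j; rewrite !mxE -/(lam i).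
  by case: eqVneq => [->|_]; rewrite !(mulr1n, mulr0n) // polyC0 mulr0 subr0.
by rewrite det_diag; apply: eq_bigr => i _; rewrite mxE.
Qed.

Let tr_diag (B : 'M[algC]_n) : \tr (invmx P *m B *m P) = \tr B.
Proof. by rewrite mxtrace_mulC mulmxA mulmxV // mul1mx. Qed.

Let AAE : A *m A = invmx P *m diag_mx (\row_i lam i ^+ 2) *m P.
Proof.
rewrite {1 2}AE !mulmxA -(mulmxA _ P) mulmxV // mulmx1; congr (_ *m P).
by rewrite -mulmxA; congr (_ *m _); rewrite mulmx_diag; congr diag_mx.
Qed.

Let AAAE : A *m A *m A = invmx P *m diag_mx (\row_i lam i ^+ 3) *m P.
Proof.
rewrite AAE {1}AE !mulmxA -(mulmxA _ P) mulmxV // mulmx1; congr (_ *m P).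
rewrite -mulmxA; congr (_ *m _); rewrite mulmx_diag; congr diag_mx.
by apply/matrixP => k i; rewrite !mxE -exprSr.
Qed.

Lemma adj_spectrum (v0 : V) : exists (l : 'I_n -> algC) (i0 : 'I_n),
  [/\ forall f g : {poly algC},
        \det (f%:M - g *: map_mx polyC A) = \prod_i (f - g * (l i)%:P),
      l i0 = d%:R,
      forall i, i != i0 -> 0 < d%:R - l i &
      [/\ \sum_i l i = \tr A, \sum_i l i ^+ 2 = \tr (A *m A) &
          \sum_i l i ^+ 3 = \tr (A *m A *m A)]].
Proof.
have [i0 li0] := lam_degree_exists v0; exists lam, i0; split=> //.
- move=> i ni; rewrite lt0r subr_eq0 eq_sym.
  rewrite lam_bound andbT.
  by apply: contraNneq ni => li; rewrite (lam_degree_unique li li0).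
split.
- by rewrite [in RHS]AE tr_diag mxtrace_diag.
- by rewrite AAE tr_diag mxtrace_diag; apply: eq_bigr => i _; rewrite mxE.
- by rewrite AAAE tr_diag mxtrace_diag; apply: eq_bigr => i _; rewrite mxE.
Qed.

Lemma tr_adj : \tr A = 0.
Proof. by rewrite trace_fmx big1 // => x _; rewrite (negPf (esimple.2 x)). Qed.

Lemma tr_adj2 : \tr (A *m A) = (n * d)%:R.
Proof.
rewrite fmxM trace_fmx natrM mulr_natl -sumr_const; apply: eq_bigr => x _.
rewrite -(sum_nbr ereg x); apply: eq_bigr => y _.
by rewrite (esym y x); case: (e x y); rewrite ?mulr1 ?mulr0.
Qed.

(** The trace counts closed walks of length three, and the given triangle is one of them. *)
Lemma tr_adj3_gt0 x y z : e x y -> e y z -> e z x -> 0 < \tr (A *m A *m A).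
Proof.
move=> exy eyz ezx; rewrite !fmxM trace_fmx.
have nn (a b c : V) : 0 <= (e a b)%:R * (e b c)%:R :> algC by rewrite mulr_ge0 ?ler0n.
have nnn (a c b : V) : 0 <= (\sum_j (e a j)%:R * (e j b)%:R) * (e b c)%:R :> algC.
  by rewrite mulr_ge0 ?ler0n // sumr_ge0.
rewrite (bigD1 x) //= ltr_wpDr //; first by apply: sumr_ge0 => ? _; apply: sumr_ge0.
rewrite (bigD1 z) //= ltr_wpDr //; first by apply: sumr_ge0.
by rewrite (bigD1 y) //= exy eyz ezx !mulr1 ltr_wpDr ?ltr01 // sumr_ge0.
Qed.

End Spectrum.

(** * Kemeny's constant of a monic quadratic *)

Lemma quadratic_splits (b c : algC) : exists x y : algC,
  [/\ x + y = b, x * y = c & 'X^2 - b%:P * 'X + c%:P = ('X - x%:P) * ('X - y%:P)].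
Proof.
pose s := sqrtC (b ^+ 2 - 4 * c); have ss : s ^+ 2 = b ^+ 2 - 4 * c by exact: sqrtCK.
have two_neq0 : 2 != 0 :> algC by rewrite pnatr_eq0.
pose x := (b + s) / 2; pose y := (b - s) / 2.
have xyb : x + y = b by rewrite /x /y; field.
have xyc : x * y = c.
  have -> : x * y = (b ^+ 2 - s ^+ 2) / (2 * 2) by rewrite /x /y; field.
  by rewrite ss; field.
exists x, y; split=> //; move: x y xyb xyc => x y <- <-.
by rewrite polyCD polyCM; ring.
Qed.

Lemma monic_quadratic (b c : algC) : 'X^2 - b%:P * 'X + c%:P \is monic.
Proof. by have [x [y [_ _ ->]]] := quadratic_splits b c; rewrite monicMl ?monicXsubC. Qed.

Lemma kemeny_poly_quadratic (b c : algC) : 1 - b + c != 0 ->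
  kemeny_poly ('X^2 - b%:P * 'X + c%:P) = (2 - b) / (1 - b + c).
Proof.
have [x [y [<- <- ->]]] := quadratic_splits b c.
have -> : 1 - (x + y) + x * y = (1 - x) * (1 - y) by ring.
rewrite mulf_eq0 negb_or => /andP[x1 y1]; rewrite kemeny_poly_quad.
by field; rewrite x1 y1.
Qed.

(** The case excluded above: [1] is a root and contributes [0^-1 = 0], leaving only the root [c]. *)
Lemma kemeny_poly_quadratic1 (c : algC) :
  kemeny_poly ('X^2 - (1 + c)%:P * 'X + c%:P) = (1 - c)^-1.
Proof.
have -> : 'X^2 - (1 + c)%:P * 'X + c%:P = ('X - 1%:P) * ('X - c%:P).
  by rewrite polyCD; ring.
by rewrite kemeny_poly_quad subrr invr0 add0r.
Qed.

(** * Both constants in terms of the adjacency eigenvalues *)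

Section Difference.
Variables (V : finType) (e : rel V) (d : nat).
Hypotheses (esimple : simple_graph e) (ereg : regular e d) (d3 : (3 <= d)%N).
Let n := #|V|.
Variables (l : 'I_n -> algC) (i0 : 'I_n).
Hypothesis det_adj : forall f g : {poly algC},
  \det (f%:M - g *: map_mx polyC (adj e)) = \prod_i (f - g * (l i)%:P).
Hypotheses (li0 : l i0 = d%:R) (l_neq : forall i, i != i0 -> d%:R - l i != 0).

Let D : algC := d%:R.
Let N : algC := n%:R.
Let S : algC := \sum_(i | i != i0) (D - l i)^-1.

Let D0 : D != 0. Proof. by rewrite pnatr_eq0; case: d d3. Qed.
Let D1 : D - 1 != 0. Proof. by rewrite subr_eq0 pnatr_eq1; case: d d3 => [|[]]. Qed.
Let D2 : D - 2 != 0.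
Proof. by rewrite subr_eq0 eqr_nat; case: d d3 => [|[|[]]]. Qed.

(** Each factor [X] has value [1], which accounts for [N * D - N]; an eigenvalue [l i] other than
    [d] contributes [1 / (1 - l i / d) = d / (d - l i)], and [d] itself contributes [0]. *)
Lemma Ke_spectral : Ke e = N * D - N + D * S.
Proof.
have kX : kemeny_poly 'X = 1.
  by have := kemeny_poly_XsubC 0; rewrite polyC0 !subr0 invr1.
have := congr1 kemeny_poly (char_poly_Pe ereg).
rewrite det_adj.
under eq_bigr do rewrite -polyCM.
have pm (s : algC) : 'X - s%:P \is monic by exact: monicXsubC.
rewrite !kemeny_polyM ?char_poly_monic ?monic_exp ?monicX ?monic_prod //.
rewrite !kemeny_polyX ?monicX // kX kemeny_poly_prod // -kemenyE -/(Ke e).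
rewrite (card_arc ereg) natrM -/N -/D => /(canRL (addrK _)) ->.
rewrite addrAC; congr (_ + _).
rewrite (bigD1 i0) //= kemeny_poly_XsubC li0 mulVf // subrr invr0 add0r.
rewrite mulr_sumr; apply: eq_bigr => i /l_neq; rewrite -/D => li.
by rewrite kemeny_poly_XsubC -[X in X - _](mulVf D0) -mulrBr invfM invrK.
Qed.

(** With [q] the value of [X^2 - c^2], the powers contribute [(N D / 2 - N) q = N (D - 1)^2 / D].
    The index [i0] contributes [1 / (1 - c)], and every other one [1 + (D - 2) / (D - l i)]. *)
Lemma Knb_spectral :
  Knb e = N * (D - 1) ^+ 2 / D + (D - 1) / (D - 2) + (N - 1) + (D - 2) * S.
Proof.
pose c := (D - 1)^-1.
have c1 : 1 - c = (D - 2) / (D - 1) by rewrite /c; field.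
have c2 : 1 + c = D / (D - 1) by rewrite /c; field.
have sqE : 'X^2 - (c ^+ 2)%:P = ('X - c%:P) * ('X - (- c)%:P).
  by rewrite polyCN rmorphXn /=; ring.
have sqm : 'X^2 - (c ^+ 2)%:P \is monic by rewrite sqE monicMl ?monicXsubC.
have facE i : 'X^2 + c%:P - c%:P * 'X * (l i)%:P
              = 'X^2 - (c * l i)%:P * 'X + c%:P by rewrite polyCM; ring.
have := congr1 kemeny_poly (char_poly_Pnb esimple ereg (ltnW d3)).
rewrite -/D -/c det_adj; under eq_bigr do rewrite facE.
have pm i : 'X^2 - (c * l i)%:P * 'X + c%:P \is monic by exact: monic_quadratic.
rewrite !(kemeny_polyM, kemeny_polyX) ?(monicMl, monic_exp, monic_prod, char_poly_monic) //.
rewrite kemeny_poly_prod // -kemenyE -/(Knb e) sqE kemeny_poly_quad opprK c1 c2.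
rewrite (bigD1 i0) //= li0 -/D.
(* This puts the quadratic at [l i0 = d] in the form having [1] as a root. *)
have -> : c * D = 1 + c by rewrite /c; field.
rewrite kemeny_poly_quadratic1 c1.
have -> : \sum_(i | i != i0) kemeny_poly ('X^2 - (c * l i)%:P * 'X + c%:P)
          = (N - 1) + (D - 2) * S.
  have -> : N - 1 = \sum_(i | i != i0) (1 : algC).
    have := sumr_const [pred i : 'I_n | true] (1 : algC).
    by rewrite (bigD1 i0) //= card_ord /N => <-; ring.
  rewrite mulr_sumr -big_split; apply: eq_bigr => i /l_neq; rewrite -/D => li.
  have cli : 1 - c * l i + c = (D - l i) / (D - 1) by rewrite /c; field.
  rewrite kemeny_poly_quadratic cli ?mulf_neq0 ?invr_eq0 //= /c.
  by field; rewrite li D1.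
rewrite -[_ *+ #|{: arc e}|]mulr_natr (card_arc ereg) natrM -/N -/D.
rewrite -[_ *+ #|V|]mulr_natr -/N.
move=> E; have two_neq0 : 2 != 0 :> algC by rewrite pnatr_eq0.
apply: (mulfI two_neq0); rewrite mulr_natl mulr2n.
by move: E => /(canRL (addrK _)) /(canRL (addrK _)) ->; field; rewrite D0 D1 D2.
Qed.

Lemma Ke_sub_Knb : Ke e - Knb e = 2 * S - N / D - (D - 2)^-1.
Proof. rewrite Ke_spectral Knb_spectral; field; by rewrite D0 D2. Qed.
End Difference.

(** * Counting constraints and recognition of the exceptional graphs *)

Section SmallGraphs.
Variables (V : finType) (e : rel V) (d : nat).
Hypotheses (esimple : simple_graph e) (ereg : regular e d).

Let esym x y : e x y = e y x. Proof. exact: esimple.1. Qed.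
Let eirr x : e x x = false. Proof. exact/negbTE/esimple.2. Qed.

Lemma degree_lt_card (v0 : V) : (d < #|V|)%N.
Proof.
have V0 : (0 < #|V|)%N by apply/card_gt0P; exists v0.
rewrite -(ereg v0) -(prednK V0) ltnS -(cardC1 v0).
apply/subset_leq_card/subsetP => w; rewrite !inE => ew.
by apply: contraTneq ew => ->; rewrite eirr.
Qed.

(** The neighbourhood of [x] lies in the complement of [x] and has the same size, so the two
    coincide. *)
Lemma complete_graph_iso : #|V| = d.+1 -> graph_iso e (@complete_rel d.+1).
Proof.
move=> nd; have eE x y : e x y = (x != y).
  have : [pred w | e x w] \subset predC1 x.
    by apply/subsetP => w; rewrite !inE => exw; apply: contraTneq exw => ->; rewrite eirr.
  move/subset_cardP => /(_ _) eqx.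
  have : #|[pred w | e x w]| = #|predC1 x| by rewrite -/(deg e x) ereg cardC1 nd.
  by move/eqx/(_ y); rewrite !inE eq_sym.
rewrite -nd; exists enum_rank; split; first exact: enum_rank_bij.
by move=> x y; rewrite eE /complete_rel (inj_eq enum_rank_inj).
Qed.

(** The degree sum splits into arcs ascending and arcs descending in the enumeration of [V];
    reversal matches the two halves. *)
Lemma handshake : ~~ odd (#|V| * d).
Proof.
have -> : (#|V| * d = \sum_x \sum_y e x y)%N.
  rewrite -sum_nat_const; apply: eq_bigr => x _.
  rewrite -(ereg x) /deg -sum1_card big_mkcond.
  by apply: eq_bigr => y _; rewrite inE; case: (e x y).
pose lt (x y : V) := (enum_rank x < enum_rank y)%N.
have -> : (\sum_x \sum_y e x y
           = \sum_x \sum_y (e x y && lt x y) + \sum_x \sum_y (e x y && lt y x))%N.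
  rewrite -big_split; apply: eq_bigr => x _; rewrite -big_split; apply: eq_bigr => y _ /=.
  rewrite /lt; case exy: (e x y) => //=; case: ltngtP => // /val_inj/enum_rank_inj xy.
  by rewrite xy eirr in exy.
rewrite [X in (_ + X)%N]exchange_big /=.
under [X in (_ + X)%N]eq_bigr do under eq_bigr do rewrite esym.
by rewrite addnn odd_double.
Qed.

(** The parts are [M], the neighbourhood of [v0], and its complement. A neighbour of [x] in [M]
    cannot lie in [M], and both sets have three elements, so [x] is adjacent to exactly the
    complement. *)
Lemma triangle_free_K33 (v0 : V) : #|V| = 6 -> d = 3 ->
  (forall x y z, e x y -> e y z -> ~~ e z x) -> graph_iso e K33_rel.
Proof.
move=> n6 d3 notri.
pose N x := [set w | e x w].
have cardN x : #|N x| = 3 by rewrite cardsE -d3 -(ereg x).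
have cardNC x : #|~: N x| = 3 by rewrite cardsCs setCK n6 cardN.
pose M := N v0.
have NM x : x \in M -> N x = ~: M.
  move=> xM; apply/eqP; rewrite eqEcard cardN cardNC leqnn andbT.
  apply/subsetP => y; rewrite !inE => exy; rewrite inE in xM.
  by rewrite esym (notri v0 x).
have NMC x : x \notin M -> N x = M.
  move=> xM; apply/eqP; rewrite eq_sym eqEcard !cardN leqnn andbT.
  apply/subsetP => y /NM/setP/(_ x); rewrite !inE esym => ->.
  by rewrite inE in xM.
have eE x y : e x y = ((x \in M) != (y \in M)).
  have -> : e x y = (y \in N x) by rewrite inE.
  have [/NM->|/NMC->] := boolP (x \in M); first by rewrite in_setC; case: (y \in M).
  by case: (y \in M).
pose side (b : bool) := enum (if b then M else ~: M).
have szside b : size (side b) = 3 by rewrite -cardE; case: b; rewrite ?cardNC ?cardN.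
have inside x : x \in side (x \in M) by rewrite mem_enum; case: ifP; rewrite ?in_setC => ->.
(* A vertex goes to its side and its position there; the positions are below [3], so [inord] keeps
   them. *)
pose f x : bool * 'I_3 := (x \in M, inord (index x (side (x \in M)))).
have idx x : (index x (side (x \in M)) < 3)%N.
  by rewrite -[X in (_ < X)%N](szside (x \in M)) index_mem inside.
have f_inj : injective f.
  move=> x y [xyM /(congr1 val)]; rewrite /= !inordK ?idx // => ixy.
  by rewrite -(nth_index x (inside x)) ixy xyM nth_index ?inside.
exists f; split; last by move=> x y; rewrite eE.
by apply: inj_card_bij => //; rewrite card_prod card_bool card_ord n6.
Qed.

End SmallGraphs.

(** * Lower bounds for sums of reciprocals *)

Lemma sum_inv_ge (I : finType) (P : pred I) (x : I -> algC)
    (k := \sum_(i | P i) 1) (X := \sum_(i | P i) x i) :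
  (forall i, P i -> 0 < x i) -> 0 < X -> k ^+ 2 / X <= \sum_(i | P i) (x i)^-1.
Proof.
move=> x0 X0; have Xn : X != 0 by rewrite gt_eqF.
have k0 : 0 <= k by apply: sumr_ge0.
(* The summand is the tangent line of the reciprocal at the mean [X / k], which lies below it by
   convexity. *)
have -> : k ^+ 2 / X = \sum_(i | P i) (2 * k / X * 1 - k ^+ 2 / X ^+ 2 * x i).
  by rewrite sumrB -!mulr_sumr -/k -/X; field.
apply: ler_sum => i Pi; have xi := x0 i Pi; have xn : x i != 0 by rewrite gt_eqF.
rewrite -subr_ge0.
have -> : (x i)^-1 - (2 * k / X * 1 - k ^+ 2 / X ^+ 2 * x i)
          = (x i)^-1 * (1 - x i * k / X) ^+ 2 by field; rewrite xn Xn.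
rewrite mulr_ge0 ?invr_ge0 ?(ltW xi) // real_exprn_even_ge0 // rpredB ?rpred1 //.
by rewrite ger0_real // divr_ge0 ?mulr_ge0 ?(ltW xi) ?(ltW X0).
Qed.

(* The cubic interpolates [(3 - l)^-1] to second order at the eigenvalues
   [0] and [-3] of [K_{3,3}]. *)
Lemma inv_ge_cubic (l : algC) : 0 < 3 - l ->
  (l ^+ 3 + 9 * l ^+ 2 + 36 * l + 108) / 324 <= (3 - l)^-1.
Proof.
move=> l3; have ln : 3 - l != 0 by rewrite gt_eqF.
have lr : l \is Num.real.
  by rewrite -[l](subKr 3) rpredB ?realn // gtr0_real.
rewrite -subr_ge0.
have -> : (3 - l)^-1 - (l ^+ 3 + 9 * l ^+ 2 + 36 * l + 108) / 324
          = (l * (3 + l)) ^+ 2 / (324 * (3 - l)) by field.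
apply: divr_ge0; last by rewrite mulr_ge0 ?ler0n ?(ltW l3).
by rewrite real_exprn_even_ge0 // rpredM // rpredD ?realn.
Qed.

(** The last alternative is [2 (n - 1)^2 / (n d) > n / d + 1 / (d - 2)] with denominators cleared
    and negative terms moved across. *)
Lemma regular_size_bound (n d : nat) : (3 <= d)%N -> (d < n)%N ->
  ~~ odd (n * d) ->
  [\/ (n, d) = (4, 3), (n, d) = (5, 4), (n, d) = (6, 3) |
      (n * (5 * (d - 2) + 2) < (n ^ 2 + 2) * (d - 2))%N].
Proof.
move=> d3 dn odd_nd.
have [d5|d5] := leqP 5 d.
  apply: Or44; have : (3 <= d - 2)%N by lia.
  have : (6 <= n)%N by lia.
  move: (d - 2)%N => k; nia.
have [d4|d4] := eqVneq d 4%N.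
  rewrite d4 in dn *; have [->|n5] := eqVneq n 5; first exact: Or42.
  by apply: Or44 => /=; nia.
have dE : d = 3 by lia.
rewrite dE in dn odd_nd *.
have [->|n4] := eqVneq n 4; first exact: Or41.
(* Parity rules out a cubic graph on five vertices. *)
have [n5|n5] := eqVneq n 5; first by rewrite n5 in odd_nd.
have [->|n6] := eqVneq n 6; first exact: Or43.
by apply: Or44 => /=; nia.
Qed.

(** * Comparison of the two constants *)

Theorem theorem3p3 (V : finType) (e : rel V) (d : nat) (v0 : V) :
  simple_graph e -> connected e -> regular e d -> (3 <= d)%N ->
  ~ graph_iso e (@complete_rel 4) ->
  ~ graph_iso e (@complete_rel 5) ->
  ~ graph_iso e K33_rel ->
  Knb e < Ke e.
Proof.
move=> esimple econn ereg d3 nK4 nK5 nK33.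
have [l [i0 [det_adj li0 l_lt [tr1 tr2 tr3]]]] := adj_spectrum esimple econn ereg v0.
have l_neq i : i != i0 -> d%:R - l i != 0 by move=> /l_lt; apply: lt0r_neq0.
rewrite -subr_gt0 (Ke_sub_Knb esimple ereg d3 det_adj li0 l_neq).
have drop_i0 (F : 'I_#|V| -> algC) : \sum_(i | i != i0) F i = \sum_i F i - F i0.
  by rewrite [in RHS](bigD1 i0) //= addrAC subrr add0r.
have sum1 : \sum_(i | i != i0) (1 : algC) = #|V|%:R - 1.
  by rewrite drop_i0 sumr_const card_ord.
have [[nE dE]|[nE dE]|[nE dE]|bound] :=
    regular_size_bound d3 (degree_lt_card esimple ereg v0) (handshake esimple ereg).
- by case: nK4; have := complete_graph_iso esimple ereg; rewrite nE dE; apply.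
- by case: nK5; have := complete_graph_iso esimple ereg; rewrite nE dE; apply.
- have t3 : 0 < \tr (adj e *m adj e *m adj e).
    have [/existsP[x /existsP[y /existsP[z /and3P[exy eyz ezx]]]]|notri] :=
      boolP [exists x, exists y, exists z, [&& e x y, e y z & e z x]].
      exact: tr_adj3_gt0 exy eyz ezx.
    case: nK33; apply: (triangle_free_K33 esimple ereg v0) => // x y z exy eyz.
    apply: contraNN notri => ezx.
    by apply/existsP; exists x; apply/existsP; exists y; apply/existsP; exists z; apply/and3P.
  move: (\tr (adj e *m adj e *m adj e)) t3 tr3 => t t3 tr3.
  have nR : #|V|%:R = 6 :> algC by rewrite nE.
  (* Removing the eigenvalue [3] from the traces [t], [18] and [0] gives [(t - 27) + 9 * (18 - 9) +
     36 * (0 - 3) + 108 * 5 = t + 486]. *)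
  have cubic : (t + 486) / 324
         <= \sum_(i | i != i0) (d%:R - l i)^-1.
    rewrite dE in li0 l_lt *.
    apply: le_trans (ler_sum _ (fun i ni => inv_ge_cubic (l_lt i ni))).
    rewrite -mulr_suml ler_pM2r ?invr_gt0 ?ltr0n //.
    have -> : \sum_(i | i != i0) (l i ^+ 3 + 9 * l i ^+ 2 + 36 * l i + 108)
        = \sum_(i | i != i0) l i ^+ 3 + 9 * \sum_(i | i != i0) l i ^+ 2
          + 36 * \sum_(i | i != i0) l i + 108 * \sum_(i | i != i0) 1.
      by rewrite !mulr_sumr -!big_split; apply: eq_bigr => i _; rewrite /= mulr1.
    rewrite sum1 !drop_i0 tr1 tr2 tr3 li0 (tr_adj esimple).
    rewrite (tr_adj2 esimple ereg) natrM nR dE le_eqVlt; apply/orP; left; apply/eqP.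
    ring.
  rewrite nR dE.
  have : 0 < t / 162 by rewrite divr_gt0 ?ltr0n.
  move/lt_le_trans; apply.
  (* The constant part [2 * 486 / 324 = 3] cancels [6 / 3 + 1] exactly, so strictness comes from the
     triangle alone. *)
  have -> : t / 162
      = 2 * ((t + 486) / 324) - 6 / 3 - (3 - 2)^-1 by field.
  by rewrite !lerD2r ler_pM2l ?ltr0n // -dE.
have n0 : (0 < #|V|)%N by exact: leq_ltn_trans (degree_lt_card esimple ereg v0).
pose N : algC := #|V|%:R; pose D : algC := d%:R.
have N0 : 0 < N by rewrite ltr0n.
have D0 : 0 < D by rewrite ltr0n; apply: leq_trans d3.
have D2 : D - 2 = (d - 2)%:R by rewrite natrB // ltnW.
have D20 : 0 < D - 2 by rewrite D2 ltr0n subn_gt0.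
(* The gap at [i0] is zero and the adjacency matrix has trace zero. *)
have sum_gap : \sum_(i | i != i0) (D - l i) = N * D.
  rewrite sumrB !drop_i0 tr1 (tr_adj esimple) sumr_const card_ord li0 -mulr_natl.
  by rewrite -/N -/D; ring.
have amhm : (N - 1) ^+ 2 / (N * D) <= \sum_(i | i != i0) (D - l i)^-1.
  by rewrite -sum1 -sum_gap; apply: sum_inv_ge l_lt _; rewrite sum_gap mulr_gt0.
apply: (@lt_le_trans _ _ (2 * ((N - 1) ^+ 2 / (N * D)) - N / D - (D - 2)^-1)); last first.
  by rewrite !lerD2r ler_pM2l ?ltr0n.
have -> : 2 * ((N - 1) ^+ 2 / (N * D)) - N / D - (D - 2)^-1
    = ((N ^+ 2 + 2) * (D - 2) - N * (5 * (D - 2) + 2)) / (N * D * (D - 2)).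
  by field; rewrite !gt_eqF.
rewrite divr_gt0 ?mulr_gt0 // D2 subr_gt0 /N.
by rewrite -natrX -!natrM -!natrD -!natrM ltr_nat.
Qed.
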